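(* Let $n\ge1$, let $\sigma\in\mathcal{S}_n$ be a cycle of length $n$, and let $\Gamma_n=(V_n,\Psi)$, $\prec$ and $f$ be as in the context. Then for every vertex $\langle k,l\rangle\in V_n$, $$|f(\langle k,l\rangle)|=\frac1k\left((k-1)!\left(\frac nk\right)^{k-1}-\sum_{\langle r,t\rangle\prec\langle k,l\rangle} r\,|f(\langle r,t\rangle)|\right).$$
   Context: $\mathbb{N}$ is the set of nonnegative integers; $[n]=\{1,\dots,n\}$; $\mathcal{S}_n$ is the symmetric group on $[n]$ with products composed left to right, $(\alpha\beta)(i)=\beta(\alpha(i))$. For $x,y\in[n]$, $x\odot y$ is the element of $[n]$ congruent to $xy$ mod $n$. $\alpha,\beta\in\mathcal{S}_n$ are $\sigma$-equivalent if $\sigma^a\alpha=\beta\sigma^b$ for some $a,b\in\mathbb{N}$; $K_\xi$ denotes the class of $\xi$ and $Q_n$ the set of classes. The directed graph $\Gamma_n=(V_n,\Psi)$ with $V_n\subseteq[n]\times[n]$ is built as follows: (1) for each $l$ with $1\le l<n$ and $\gcd(l,n)=1$, $\langle1,l\rangle\in V_n$; (2) whenever $\langle k,l\rangle\in V_n$ and $p$ is a prime divisor of $n$ with $kp\mid n$, then $\langle kp,l\odot p\rangle\in V_n$ and $(\langle k,l\rangle,\langle kp,l\odot p\rangle)\in\Psi$; (3) repeat (2) until nothing new arises (so $V_n,\Psi$ are the smallest sets closed under these rules). Write $\langle r,t\rangle\prec\langle k,l\rangle$ if there is a directed path of positive length in $\Gamma_n$ from $\langle r,t\rangle$ to $\langle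 k,l\rangle$. Define $f$ on $V_n$ by: for $\langle k,l\rangle\in V_n$ with $k<n$, $f(\langle k,l\rangle)$ is the set of classes $K_\xi\in Q_n$ with $\sigma^k\xi=\xi\sigma^l$ and $\sigma^{k_1}\xi\ne\xi\sigma^{l_1}$ for all $1\le k_1<k$ and all $l_1$; and $f(\langle n,n\rangle)$ is the set of classes $K_\xi\in Q_n$ with $|K_\xi|=n^2$. *)

(* Defs.v *)
From HB Require Import structures.
From Stdlib Require Import Relation_Operators.
From mathcomp Require Import all_boot all_order all_algebra all_fingroup.
From mathcomp Require Import boolp.

Set Implicit Arguments.
Unset Strict Implicit.
Unset Printing Implicit Defensive.

(* Permutations of [n] = {1, .., n} are represented by 'S_n, the permutations *)
(* of {0, .., n-1}; the product of 'S_n is composed left to right (permM).    *)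

Definition cycle_of_length (T : finType) (m : nat) (s : {perm T}) : bool :=
  [exists x, (#|porbit s x| == m) && perm_on (porbit s x) s].

Section SigmaClasses.

Variables (n : nat) (sigma : 'S_n).

Definition sigma_equiv (alpha beta : 'S_n) : Prop :=
  exists a b : nat, (sigma ^+ a * alpha = beta * sigma ^+ b)%g.

Definition sigma_class (xi : 'S_n) : {set 'S_n} :=
  [set eta | `[< sigma_equiv xi eta >]].

Definition sigma_classes : {set {set 'S_n}} :=
  [set sigma_class xi | xi : 'S_n].

Definition minimal_shift (k l : nat) (xi : 'S_n) : Prop :=
  (sigma ^+ k * xi = xi * sigma ^+ l)%g /\
  forall k1 l1 : nat, 1 <= k1 < k ->
    (sigma ^+ k1 * xi)%g <> (xi * sigma ^+ l1)%g.

(* Meaningful on the vertices of Gamma_n only, where k = n forces l = n. *)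
Definition vertex_classes (v : nat * nat) : {set {set 'S_n}} :=
  if v.1 < n then [set sigma_class xi | xi : 'S_n & `[< minimal_shift v.1 v.2 xi >]]
  else [set C in sigma_classes | #|C| == n ^ 2].

End SigmaClasses.

(* The representative of x * y modulo n in {1, .., n} (not in {0, .., n-1}). *)
Definition odot (n x y : nat) : nat :=
  if n %| x * y then n else (x * y) %% n.

Inductive vertex (n : nat) : nat * nat -> Prop :=
| vertex_unit l : 1 <= l < n -> coprime l n -> vertex n (1, l)
| vertex_mul k l p : vertex n (k, l) -> prime p -> p %| n -> k * p %| n ->
    vertex n (k * p, odot n l p).

Inductive edge (n : nat) : nat * nat -> nat * nat -> Prop :=
| edge_mul k l p : vertex n (k, l) -> prime p -> p %| n -> k * p %| n ->
    edge n (k, l) (k * p, odot n l p).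

Definition prec (n : nat) : nat * nat -> nat * nat -> Prop :=
  clos_trans (nat * nat) (edge n).

(* Main.v *)
Require Import Defs.
From mathcomp Require Import all_boot all_order all_algebra all_fingroup.
From mathcomp Require Import all_solvable.
From mathcomp Require Import boolp.
From Stdlib Require Import Relation_Operators.

(** For a vertex [(k, l)] let [S k l] be the set of all [xi] with
    [sigma ^+ k * xi = xi * sigma ^+ l].  Since [l = u * k] modulo [n] for a unit
    [u], the permutations [sigma ^+ k] and [sigma ^+ l] are conjugate, so [S k l]
    is a coset of the centralizer of [sigma ^+ k], a product of [k] disjoint
    cycles of length [n / k]; hence [#|S k l| = k! (n / k)^k].  On the other
    hand, the class of [xi] is the double coset of [xi] modulo [<[sigma]>]; it
    has [n r] elements, where [r], the shift period of [xi], generates the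
    exponents [a] such that [sigma ^+ a] is conjugated by [xi] into
    [<[sigma]>].  Sorting the elements of [S k l] by their minimal shift
    [(r, t)], which is either [(k, l)] or a vertex preceding it, gives
    [k! (n / k)^k = \sum n r #|f (r, t)|]; dividing by [n] is the recurrence. *)

Import GRing.Theory.

(** * Double cosets of a cyclic group and the shift period *)

Section ShiftPeriod.

Local Open Scope group_scope.
Variable gT : finGroupType.
Implicit Types s x : gT.

(** The index of [<[s]> :&: <[s]> :^ x^-1] in [<[s]>]: this form suits the size of a double coset,
    and [dvdn_shift_period] relates it to exponents. *)
Definition shift_period s x : nat := #[s] %/ #|<[s]> :&: <[s]> :^ x^-1|.

Lemma shift_period_dvd_order s x : shift_period s x %| #[s].
Proof.
by rewrite /shift_period; apply: dvdn_div; rewrite orderE cardSg ?subsetIl.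
Qed.

Lemma shift_period_gt0 s x : 0 < shift_period s x.
Proof. exact: dvdn_gt0 (order_gt0 s) (shift_period_dvd_order s x). Qed.

Lemma mem_cycle_exp s d a : d %| #[s] -> (s ^+ a \in <[s ^+ d]>) = (d %| a).
Proof.
move=> d_n; apply/cycleP/idP => [[i]|/dvdnP[i ->]]; last first.
  by exists i; rewrite -expgM mulnC.
rewrite -expgM => /eqP; rewrite eq_expg_mod_order => /eqP/(congr1 (modn^~ d)).
by rewrite !modn_dvdm // modnMr => /eqP.
Qed.

(** A cyclic group has a single subgroup of each order dividing its own, so the intersection in
    [shift_period] is generated by [s ^+ shift_period s x]. *)
Lemma dvdn_shift_period s x a :
  (shift_period s x %| a) = ((s ^+ a) ^ x \in <[s]>).
Proof.
pose K := (<[s]> :&: <[s]> :^ x^-1)%G.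
have K_n : #|K| %| #[s] by rewrite orderE cardSg ?subsetIl.
have: K \in [set H : {group gT} | H \subset <[s]> & #|H| == #|K|].
  by rewrite inE subsetIl eqxx.
rewrite (cycle_sub_group K_n) inE => /eqP/(congr1 val) /= defK.
rewrite -(mem_cycle_exp s) ?shift_period_dvd_order // /shift_period -defK.
by rewrite inE mem_cycle mem_conjgV.
Qed.

(** Translation by [x^-1] on the right turns the double coset into the product of [<[s]>] and a
    conjugate of it, to which the product formula applies. *)
Lemma card_double_coset_cycle s x :
  #|<[s]> :* x * <[s]>| = (#[s] * shift_period s x)%N.
Proof.
have ->: <[s]> :* x * <[s]> = <[s]> * (<[s]> :^ x^-1) :* x.
  by rewrite conjsgE invgK !mulgA -(mulgA _ [set x^-1]) mulg_set1 mulVg mulg1.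
rewrite card_rcoset.
set K := <[s]> :&: <[s]> :^ x^-1; have K_gt0: 0 < #|K| by apply: cardG_gt0.
apply/eqP; rewrite -(eqn_pmul2r K_gt0) -mulnA /shift_period divnK; last first.
  by rewrite orderE cardSg ?subsetIl.
by rewrite -(mul_cardG <[s]> (<[s]> :^ x^-1)) cardJg.
Qed.

End ShiftPeriod.

Arguments shift_period {gT} s x.

Lemma eqn_mod_coprime_mul2l m a b c : coprime m c ->
  (m * a == m * b %[mod c]) = (a == b %[mod c]).
Proof.
move=> co_mc; wlog le_ab : a b / a <= b.
  by move=> IH; case/orP: (leq_total a b) => /IH // E; rewrite eq_sym E eq_sym.
rewrite [LHS]eq_sym [RHS]eq_sym !eqn_mod_dvd ?leq_mul2l ?le_ab ?orbT //.
by rewrite -mulnBr Gauss_dvdr // coprime_sym.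
Qed.

(** * Powers of an [n]-cycle: centralizers and conjugates *)

Section Cycle.

Local Open Scope group_scope.
Variables (n : nat) (s : 'S_n).
Hypothesis s_cycle : cycle_of_length n s.

(** The orbit of [x] is everything, so a power of [s] is determined by the image of [x]. Points
    become exponents modulo [n], and permutations can be defined by formulas on exponents. *)
Lemma cycle_of_length_coordinates :
  exists x idx, [/\ #[s] = n, forall y : 'I_n, idx y < n,
    forall y, (s ^+ idx y) x = y
    & forall i j, (s ^+ i) x = (s ^+ j) x <-> i = j %[mod n]].
Proof.
have [x /andP[/eqP card_x _]] := existsP s_cycle.
have full y : y \in porbit s x.
  suff ->: porbit s x = setT by rewrite inE.
  by apply/eqP; rewrite eqEcard subsetT cardsT card_ord card_x leqnn.
have inj_s i j : (s ^+ i) x = (s ^+ j) x -> s ^+ i = s ^+ j.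
  move=> eq_x; apply/permP => y.
  have /porbitP[c ->] := full y.
  by rewrite -!permM -!expgD addnC (addnC c) !expgD !permM eq_x.
have ord_s : #[s] = n.
  rewrite -[RHS]card_x porbit.unlock orderE card_in_imset // => a b.
  by move=> /cycleP[i ->] /cycleP[j ->]; apply: inj_s.
have ex y : exists i, (i < n) && ((s ^+ i) x == y).
  have := full y; rewrite porbit_traject card_x => /trajectP[i lt_in ->].
  by exists i; rewrite lt_in permX eqxx.
exists x, (fun y => xchoose (ex y)); split=> // [y | y | i j].
- by have /andP[] := xchooseP (ex y).
- by have /andP[_ /eqP] := xchooseP (ex y).
split=> [/inj_s/eqP | eq_ij]; first by rewrite eq_expg_mod_order ord_s => /eqP.
by congr (fun_of_perm _ x); apply/eqP; rewrite eq_expg_mod_order ord_s eq_ij.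
Qed.

Lemma order_cycle_of_length : #[s] = n.
Proof. by have [x [idx []]] := cycle_of_length_coordinates. Qed.

Lemma card_cent_cycle_exp k : 0 < n -> k %| n ->
  #|'C[s ^+ k]| = (k`! * (n %/ k) ^ k)%N.
Proof.
move=> n_gt0 k_n; set m := n %/ k.
have k_gt0 : 0 < k by apply: dvdn_gt0 k_n.
have m_gt0 : 0 < m by rewrite divn_gt0 // dvdn_leq.
have def_n : n = (m * k)%N by rewrite divnK.
have [x [idx [ord_s idx_lt idxK XE]]] := cycle_of_length_coordinates.
pose X i := (s ^+ i) x.
have XD i j : (s ^+ j) (X i) = X (i + j)%N by rewrite /X expgD permM.
have s_inj i j : X i = X j -> i = j %[mod n] by move/XE.
have s_mod i j : i = j %[mod n] -> X i = X j by move/XE.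
have {}idxK : cancel idx X by [].
have modk i j : i = j %[mod n] -> i = j %[mod k].
  by move/(congr1 (modn^~ k)); rewrite !modn_dvdm.
pose r i : 'I_k := Ordinal (ltn_pmod i k_gt0).
have rE i j : i = j %[mod k] -> r i = r j by move=> eq_ij; apply: val_inj.
(* A permutation commuting with [s ^+ k] is given by the images of the points *)
(* [X 0], .., [X k.-1]: these lie on distinct cycles of [s ^+ k], which [pe.1] *)
(* records, at arbitrary positions on them, which [pe.2] records.             *)
pose G (pe : 'S_k * {ffun 'I_k -> 'I_m}) i :=
  (pe.1 (r i) + k * (pe.2 (r i) + i %/ k))%N.
(* Adding [k * q] keeps the residue modulo [k] and raises the quotient by [q]; this yields
   commutation with [s ^+ k]. *)
have GD pe i q : G pe (i + k * q)%N = (G pe i + k * q)%N.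
  rewrite /G (rE (i + k * q)%N i); last by rewrite addnC mulnC modnMDl.
  have -> : ((i + k * q) %/ k = i %/ k + q)%N by rewrite addnC mulnC divnMDl // addnC.
  by rewrite !mulnDr !addnA.
have G_mod pe i : G pe (i %% n) = G pe i %[mod n].
  have e : (i %/ n * n = k * (i %/ n * m))%N by rewrite mulnC [RHS]mulnC -mulnA -def_n mulnC.
  by rewrite {2}(divn_eq i n) e addnC GD -e addnC modnMDl.
have G_inj pe i j : G pe i = G pe j %[mod n] -> i = j %[mod n].
  (* Modulo [k] only [pe.1] remains, and its injectivity gives equal residues; the offsets then
     cancel. *)
  move=> eqG; have eqr: r i = r j.
    apply: (@perm_inj _ pe.1); apply: val_inj; have:= modk _ _ eqG.
    by rewrite /G ![(pe.1 _ + _)%N]addnC ![(k * _)%N]mulnC !modnMDl !modn_small.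
  have /eqP := eqG; rewrite /G eqr eqn_modDl !mulnDr eqn_modDl => /eqP eq_q.
  have := congr1 val eqr => /= eq_m.
  rewrite (divn_eq i k) (divn_eq j k) eq_m; apply/eqP; rewrite eqn_modDr.
  by rewrite !(mulnC _ k); apply/eqP.
have g_inj pe : injective (fun y => X (G pe (idx y))).
  move=> y z /s_inj/G_inj/s_mod; by rewrite !idxK.
pose g pe : 'S_n := perm (@g_inj pe).
have gX pe i : g pe (X i) = X (G pe i).
  rewrite permE; apply: s_mod.
  have: idx (X i) = i %[mod n] by apply: s_inj; rewrite idxK.
  rewrite -(G_mod pe i) => <-; by rewrite G_mod.
have g_injective : injective g.
  move=> [p e] [p' e'] eq_g.
  have eqG (j : 'I_k) : (p j = p' j) * (e j = e' j).
    have := congr1 (fun u : 'S_n => u (X j)) eq_g; rewrite !gX => /s_inj.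
    have rj : r j = j by apply: val_inj; rewrite /= modn_small.
    rewrite /G /= rj divn_small // !addn0 => eq_j.
    (* Both values lie below [n], so the congruence is an equality; remainder and quotient by [k]
       recover [p] and [e]. *)
    have lt_n (a : 'I_k) (b : 'I_m) : a + k * b < n.
      rewrite def_n; apply: (@leq_trans (b.+1 * k)); last by rewrite leq_mul2r ltn_ord orbT.
      by rewrite mulSn mulnC ltn_add2r.
    move: eq_j; rewrite !modn_small // => eq_j.
    have := congr1 (modn^~ k) eq_j; have := congr1 (divn^~ k) eq_j.
    rewrite /= ![(_ + k * _)%N]addnC ![(k * _)%N]mulnC !divnMDl // !modnMDl.
    rewrite !divn_small // !addn0 !modn_small //.
    by move=> eq_e eq_p; split; apply: val_inj.
  congr (_, _); [apply/permP | apply/ffunP] => j; by rewrite eqG.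
have ->: 'C[s ^+ k] = [set g pe | pe : _].
  apply/setP => u; apply/cent1P/imsetP => [comm_u | [pe _ ->]]; last first.
    apply/permP => y; rewrite -(idxK y) !permM gX !XD gX.
    by have := GD pe (idx y) 1%N; rewrite muln1 => ->.
  have uX i q : u (X (i + k * q)%N) = X (idx (u (X i)) + k * q)%N.
    rewrite -XD expgM -permM -(commuteX q comm_u) permM -{1}(idxK (u (X i))).
    by rewrite -expgM XD.
  have e_lt (j : 'I_k) : idx (u (X j)) %/ k < m by rewrite ltn_divLR // -def_n.
  (* If [u] sends [X i] and [X j] to the same cycle of [s ^+ k], a power of [s ^+ k] carries one
     image to the other, hence [X i] to [X j], so [i] and [j] agree modulo [k]. *)
  have p_inj : injective (fun j : 'I_k => r (idx (u (X j)))).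
    move=> i j /(congr1 val) /= eq_c.
    wlog le_c : i j eq_c / idx (u (X i)) <= idx (u (X j)).
      move=> IH; have [|/ltnW] := leqP (idx (u (X i))) (idx (u (X j))); first exact: IH.
      by move=> le; apply/esym/IH.
    have /dvdnP[q def_q]: k %| idx (u (X j)) - idx (u (X i)).
      by rewrite -eqn_mod_dvd // eq_c.
    have: u (X j) = u (X (i + k * q)%N).
      by rewrite uX mulnC -def_q subnKC // idxK.
    move/perm_inj/s_inj/modk; rewrite addnC mulnC modnMDl !modn_small // => eq_ij.
    by apply/esym/val_inj.
  exists (perm p_inj, [ffun j => Ordinal (e_lt j)]) => //.
  apply/permP => y; rewrite -(idxK y); set i := idx y; rewrite gX /G /= permE ffunE /=.
  rewrite {1}(divn_eq i k) addnC mulnC uX mulnDr addnA; congr X; congr (_ + _)%N.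
  by rewrite addnC mulnC -divn_eq.
by rewrite card_imset // card_prod card_ffun !card_ord card_Sn.
Qed.

(** Multiplying exponents by [u] is injective modulo [n] and turns steps of 1 into steps of [u];
    this is the conjugator [w]. *)
Lemma conj_cycle_exp u : coprime u n -> exists w : 'S_n, s ^ w = s ^+ u.
Proof.
move=> co_un.
have [x [idx [ord_s idx_lt idxK XE]]] := cycle_of_length_coordinates.
have w_inj : injective (fun y => (s ^+ (u * idx y)) x).
  move=> y z /XE/eqP; rewrite eqn_mod_coprime_mul2l // => /eqP/XE.
  by rewrite !idxK.
exists (perm w_inj).
suff: s * perm w_inj = perm w_inj * s ^+ u by rewrite /conjg => ->; rewrite mulKg.
apply/permP => y; rewrite !permM !permE -permM -expgD; apply/XE.
have: idx (s y) = (idx y).+1 %[mod n].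
  by apply/XE; rewrite idxK expgSr permM idxK.
by move=> eq_i; rewrite -modnMmr eq_i modnMmr mulnSr.
Qed.

End Cycle.

(** * Representatives modulo [n] in the range from 1 to [n] *)

Section Odot.

Variables (n : nat).
Hypothesis n_gt0 : 0 < n.

Lemma odot_mod x y : odot n x y = x * y %[mod n].
Proof.
by rewrite /odot; case: ifP => [/eqP->|_]; rewrite ?modnn ?modn_mod.
Qed.

Lemma odot_range x y : 1 <= odot n x y <= n.
Proof.
rewrite /odot; case: ifPn => [_|]; first by rewrite n_gt0 leqnn.
by rewrite /dvdn -lt0n => ->; rewrite ltnW ?ltn_pmod.
Qed.

Lemma eq_mod_range a b :
  1 <= a <= n -> 1 <= b <= n -> a = b %[mod n] -> a = b.
Proof.
move=> /andP[a_gt0 a_le] /andP[b_gt0 b_le].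
(* The range starts at 1; lowering both numbers by 1 makes them remainders below [n]. *)
rewrite -(prednK a_gt0) -(prednK b_gt0) in a_le b_le * => /eqP.
by rewrite -addn1 -[b.-1.+1]addn1 eqn_modDr !modn_small // => /eqP->.
Qed.

Lemma odotE t x y : 1 <= t <= n -> t = x * y %[mod n] -> t = odot n x y.
Proof.
by move=> t_range t_eq; apply: eq_mod_range (odot_range _ _) _; rewrite ?odot_mod.
Qed.

End Odot.

(** * Arithmetic of the vertices and of the path order *)

Section Vertices.

Variable n : nat.

(** The unit [u] is the second label of the vertex where the construction starts; each edge
    multiplies both labels by the same prime, modulo [n] for the second. *)
Lemma vertexE v : vertex n v ->
  [/\ 0 < n, v.1 %| n, 1 <= v.2 <= n
    & exists2 u, coprime u n & v.2 = u * v.1 %[mod n]].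
Proof.
elim=> {v} [l /andP[l_gt0 lt_ln] co_ln | k l p _ [n_gt0 _ l_le [u co_u l_eq]] p_pr _ kp_n] /=.
  split; [exact: ltn_trans lt_ln | exact: dvd1n | by rewrite l_gt0 ltnW |].
  by exists l; rewrite // muln1.
split=> //; first exact: odot_range.
by exists u; rewrite // odot_mod // -modnMml l_eq modnMml mulnA.
Qed.

Lemma vertex_gt1 v : vertex n v -> 1 < n.
Proof. by elim=> // l /andP[l_gt0 lt_ln] _; apply: leq_ltn_trans lt_ln. Qed.

Lemma vertex_range v : vertex n v -> 0 < v.1 <= n.
Proof.
by move=> /vertexE[n_gt0 v_n _ _]; rewrite (dvdn_gt0 n_gt0 v_n) dvdn_leq.
Qed.

Lemma edge_vertex v w : edge n v w -> vertex n v /\ vertex n w.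
Proof. by case=> k l p vkl p_pr p_n kp_n; split=> //; apply: vertex_mul. Qed.

Lemma prec_vertex v w : prec n v w -> vertex n v /\ vertex n w.
Proof.
elim=> [a b /edge_vertex // | a b c _ [va _] _ [_ vc]]; by split.
Qed.

(** [q] is the product of the primes along the path. *)
Lemma prec_mul v w : prec n v w ->
  exists q, [/\ 1 < q, w.1 = v.1 * q & w.2 = v.2 * q %[mod n]].
Proof.
elim=> [_ _ [k l p vkl p_pr p_n kp_n]
       | a b c _ [q [q1 -> bq]] _ [q' [q'1 -> cq']]].
  by exists p; rewrite prime_gt1 // odot_mod.
exists (q * q'); split; last by rewrite cq' -modnMml bq modnMml mulnA.
  by rewrite (leq_trans q1) // leq_pmulr // ltnW.
by rewrite mulnA.
Qed.

Lemma prec_lt v w : prec n v w -> v.1 < w.1.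
Proof.
move=> vw; have [/vertex_range/andP[v_gt0 _] _] := prec_vertex _ _ vw.
by have [q [q_gt1 -> _]] := prec_mul _ _ vw; rewrite ltn_Pmulr.
Qed.

(** Converse of [prec_mul]: the path takes the prime factors of [q] one by one, the smallest
    first. *)
Lemma mul_prec r t q : vertex n (r, t) -> 1 < q -> r * q %| n ->
  prec n (r, t) (r * q, odot n t q).
Proof.
elim/ltn_ind: q r t => q IH r t v_rt q_gt1 rq_n.
have [n_gt0 _ t_range _] := vertexE _ v_rt; rewrite /= in t_range.
have p_pr := pdiv_prime q_gt1; set p := pdiv q in p_pr.
have def_q : q = p * (q %/ p) by rewrite mulnC divnK ?pdiv_dvd.
have rp_n : r * p %| n by apply: dvdn_trans rq_n; rewrite dvdn_mul ?pdiv_dvd.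
have p_n : p %| n by apply: dvdn_trans rp_n; rewrite dvdn_mull.
have e1 : edge n (r, t) (r * p, odot n t p) by apply: edge_mul.
have [_ v1] := edge_vertex _ _ e1.
have q'_gt0 : 0 < q %/ p by rewrite divn_gt0 ?prime_gt0 // dvdn_leq ?pdiv_dvd // ltnW.
have [q'1|q'_gt1] : q %/ p = 1 \/ 1 < q %/ p.
  by move: q'_gt0; rewrite leq_eqVlt => /orP[/eqP|]; [left | right].
  by apply: t_step; rewrite def_q q'1 muln1.
apply: t_trans (t_step _ _ _ _ e1) _.
have -> : odot n t q = odot n (odot n t p) (q %/ p).
  apply: odotE; rewrite ?odot_range // odot_mod // -[RHS]modnMml odot_mod //.
  by rewrite modnMml -mulnA -def_q.
rewrite {1}def_q mulnA; apply: IH => //; last by rewrite -mulnA -def_q.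
by rewrite ltn_Pdiv ?prime_gt1 // ltnW.
Qed.

(* Units modulo [n %/ r] lift to units modulo [n]: adding a multiple of       *)
(* [n %/ r] by the part of [n] prime to [m] avoids every prime divisor of [n]. *)
Lemma gcd_vertex r t : 1 < n -> 1 <= t <= n -> gcdn t n = r -> vertex n (r, t).
Proof.
move=> n_gt1 t_range gcd_r; have n_gt0 := ltnW n_gt1.
have t_gt0 : 0 < t by case/andP: t_range.
have r_gt0 : 0 < r by rewrite -gcd_r gcdn_gt0 t_gt0.
have r_t : r %| t by rewrite -gcd_r dvdn_gcdl.
have r_n : r %| n by rewrite -gcd_r dvdn_gcdr.
pose m := t %/ r; pose x := n`_(\pi(m)^').
have m_gt0 : 0 < m by rewrite divn_gt0 // dvdn_leq.
have co_m : coprime m (n %/ r).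
  rewrite /coprime -(eqn_pmul2r r_gt0) muln_gcdl !divnK //.
  by rewrite gcd_r mul1n.
pose u := m + n %/ r * x.
have co_u : coprime u n.
  rewrite coprime_sym; apply: contraT; rewrite /coprime => gcd_neq1.
  have /pdiv_prime p_pr : 1 < gcdn n u.
    by rewrite ltn_neqAle eq_sym gcd_neq1 gcdn_gt0 n_gt0.
  set p := pdiv _ in p_pr.
  have /andP[p_n p_u] : (p %| n) && (p %| u) by rewrite -dvdn_gcd pdiv_dvd.
  (* A prime divisor of [m] divides neither [n %/ r], by coprimality, nor [x], hence not [u]. Any
     other prime divisor of [n] divides [x] but not [m], hence again not [u]. *)
  have [p_m|p_m] := boolP (p %| m).
    move: p_u; rewrite dvdn_addr // Euclid_dvdM // => /orP[p_nr | p_x].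
      have : p %| gcdn m (n %/ r) by rewrite dvdn_gcd p_m.
      by rewrite (eqP co_m) dvdn1 => /eqP p1; rewrite p1 in p_pr.
    have /pnatP := part_pnat \pi(m)^' n; rewrite -/x part_gt0 => /(_ isT p p_pr p_x).
    by rewrite !inE /= mem_primes p_pr m_gt0 p_m.
  have p_x : p %| x.
    apply: (@dvdn_trans n`_p); last first.
      by apply: sub_in_partn => q _ /eqP->; rewrite !inE /= mem_primes p_pr m_gt0 (negPf p_m).
    by rewrite p_part -{1}[p]expn1 dvdn_exp2l // logn_gt0 mem_primes p_pr n_gt0.
  by move: p_u; rewrite dvdn_addl ?(negPf p_m) // dvdn_mull.
have lt_u : u %% n < n by rewrite ltn_pmod.
have co_un : coprime (u %% n) n by rewrite coprime_modl.
have v1 : vertex n (1, u %% n).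
  apply: vertex_unit => //; rewrite lt_u andbT lt0n; apply: contraTneq co_un => ->.
  by rewrite /coprime gcd0n; case: (n) n_gt1 => [|[]].
(* Indeed [u * r] equals [t + n * x]. *)
have -> : t = odot n (u %% n) r.
  apply: odotE => //; rewrite modnMml /u mulnDl -mulnA (mulnC x) mulnA !divnK //.
  by rewrite addnC mulnC modnMDl.
have [->|r_gt1] : r = 1 \/ 1 < r.
  by move: r_gt0; rewrite leq_eqVlt => /orP[/eqP|]; [left | right].
  rewrite -(odotE n n_gt0 (u %% n)) ?muln1 //.
  by have [_ _] := vertexE _ v1.
have /prec_vertex[_] : prec n (1, u %% n) (1 * r, odot n (u %% n) r).
  by apply: mul_prec; rewrite ?mul1n.
by rewrite mul1n.
Qed.

End Vertices.

(** * Classes as double cosets, and their sizes *)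

Section Classes.

Local Open Scope group_scope.
Variables (n : nat) (s : 'S_n).
Implicit Types xi eta : 'S_n.

Lemma mem_shift_conj a xi :
  reflect (exists b, s ^+ a * xi = xi * s ^+ b) ((s ^+ a) ^ xi \in <[s]>).
Proof.
apply: (iffP (cycleP _ _)) => [] [b eq_b]; exists b.
  by rewrite -eq_b conjgE mulKVg.
by rewrite conjgE eq_b mulKg.
Qed.

(** The exponents admitting a shift equation are the multiples of the shift period, so it is the
    least positive one. *)
Lemma minimal_shiftE k l xi : 0 < k ->
  minimal_shift s k l xi <-> shift_period s xi = k /\ s ^+ k * xi = xi * s ^+ l.
Proof.
move=> k_gt0; split=> [[eq_k min_k] | [def_k eq_k]]; split=> //.
  have: shift_period s xi %| k.
    by rewrite dvdn_shift_period; apply/mem_shift_conj; exists l.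
  move/(dvdn_leq k_gt0); rewrite leq_eqVlt => /orP[/eqP // | lt_k].
  have := dvdnn (shift_period s xi); rewrite dvdn_shift_period.
  by move/mem_shift_conj=> [b] /min_k; case; rewrite shift_period_gt0.
move=> k1 l1 /andP[k1_gt0 lt_k1] eq1.
suff: shift_period s xi %| k1 by move/(dvdn_leq k1_gt0); rewrite def_k leqNgt lt_k1.
by rewrite dvdn_shift_period; apply/mem_shift_conj; exists l1.
Qed.

Lemma sigma_class_double_coset xi : sigma_class s xi = <[s]> :* xi * <[s]>.
Proof.
apply/setP => eta; rewrite inE; apply/asboolP/mulsgP.
  case=> a [b eq_ab]; exists (s ^+ a * xi) (s ^- b); rewrite ?groupV ?mem_cycle //.
    by rewrite mem_rcoset mulgK mem_cycle.
  by rewrite eq_ab mulgK.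
case=> x y; rewrite mem_rcoset => /cycleP[a eq_a]; rewrite -groupV.
move=> /cycleP[b eq_b] ->; exists a, b.
by rewrite -eq_a -eq_b mulgKV mulgK.
Qed.

Lemma sigma_class_id xi : xi \in sigma_class s xi.
Proof. by rewrite inE; apply/asboolP; exists 0%N, 0%N; rewrite mul1g mulg1. Qed.

Lemma mem_sigma_classP xi eta :
  reflect (exists a b, eta = s ^+ a * xi * s ^+ b) (eta \in sigma_class s xi).
Proof.
rewrite sigma_class_double_coset; apply: (iffP mulsgP).
  case=> x _ x_in /cycleP[b ->] ->; move: x_in; rewrite mem_rcoset.
  by move=> /cycleP[a eq_a]; exists a, b; rewrite -eq_a mulgKV.
case=> a [b ->]; exists (s ^+ a * xi) (s ^+ b); rewrite ?mem_cycle //.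
by rewrite mem_rcoset mulgK mem_cycle.
Qed.

Lemma sigma_class_eq xi eta :
  (eta \in sigma_class s xi) = (sigma_class s eta == sigma_class s xi).
Proof.
apply/idP/eqP => [|<-]; last exact: sigma_class_id.
move=> /mem_sigma_classP[a [b ->]]; rewrite !sigma_class_double_coset.
rewrite -!mulg_set1 !mulgA rcoset_id ?mem_cycle // -(mulgA _ [set s ^+ b]).
by rewrite lcoset_id ?mem_cycle.
Qed.

(** Powers of [s] commute, so the outer factors [s ^+ a] and [s ^+ b] cancel from every shift
    equation. *)
Lemma minimal_shift_class k l xi eta : eta \in sigma_class s xi ->
  minimal_shift s k l xi -> minimal_shift s k l eta.
Proof.
case/mem_sigma_classP=> a [b ->].
have shiftE k' l' : s ^+ k' * (s ^+ a * xi * s ^+ b) = s ^+ a * xi * s ^+ b * s ^+ l'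
    <-> s ^+ k' * xi = xi * s ^+ l'.
  have comm i j : s ^+ i * s ^+ j = s ^+ j * s ^+ i by rewrite -!expgD addnC.
  rewrite -(mulgA _ _ (s ^+ l')) (comm b) !mulgA (comm k') -!(mulgA (s ^+ a)).
  by split=> [/mulgI/mulIg | ->].
by case=> eq_k min_k; split=> [|k1 l1 /min_k ne_k1]; rewrite shiftE.
Qed.

Hypothesis s_cycle : cycle_of_length n s.

Lemma card_sigma_class xi : #|sigma_class s xi| = (n * shift_period s xi)%N.
Proof.
by rewrite sigma_class_double_coset card_double_coset_cycle order_cycle_of_length.
Qed.

(** [A] is a union of whole classes, each of size [n * k] because its members have shift period
    [k]. *)
Lemma card_minimal_shift k l : 0 < k ->
  let A := [set xi | `[< minimal_shift s k l xi >]] in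
  #|A| = (n * k * #|sigma_class s @: A|)%N.
Proof.
move=> k_gt0 A; rewrite -sum1_card (partition_big_imset (sigma_class s)) /=.
rewrite mulnC -sum_nat_const; apply: eq_bigr => _ /imsetP[eta eta_A ->].
have [per_eta _] : shift_period s eta = k /\ s ^+ k * eta = eta * s ^+ l.
  by apply/minimal_shiftE => //; move: eta_A; rewrite inE => /asboolP.
rewrite -per_eta -card_sigma_class -sum1_card; apply: eq_bigl => xi.
rewrite -sigma_class_eq andb_idl // => xi_eta; rewrite inE; apply/asboolP.
by apply: minimal_shift_class xi_eta _; move: eta_A; rewrite inE => /asboolP.
Qed.

(** Removes the case distinction of [vertex_classes]: if the first label is [n], so is the second,
    the shift equation is trivial, and minimality means shift period [n], that is, class size
    [n ^ 2]. *)
Lemma vertex_classesE v : vertex n v ->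
  vertex_classes s v =
    sigma_class s @: [set xi | `[< minimal_shift s v.1 v.2 xi >]].
Proof.
move=> v_vert; have [n_gt0 v_n v_range [u _ v_eq]] := vertexE _ _ v_vert.
have /andP[v_gt0 v_le] := vertex_range _ _ v_vert.
rewrite /vertex_classes; case: ltnP => [_ | n_le].
  by congr (_ @: _); apply/setP => xi.
have def_v1 : v.1 = n by apply/eqP; rewrite eqn_leq v_le.
have def_v2 : v.2 = n.
  by apply: (eq_mod_range n) => //; rewrite ?n_gt0 ?leqnn // v_eq def_v1 modnMl modnn.
have sn : s ^+ n = 1.
  by have := expg_order s; rewrite (order_cycle_of_length _ _ s_cycle).
have minE xi : minimal_shift s v.1 v.2 xi <-> #|sigma_class s xi| = (n ^ 2)%N.
  rewrite def_v1 def_v2 minimal_shiftE // card_sigma_class -mulnn.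
  rewrite sn mul1g mulg1.
  by split=> [[->] // | /eqP]; rewrite eqn_pmul2l // => /eqP.
apply/setP => C; rewrite inE; apply/andP/imsetP.
  case=> /imsetP[xi _ ->] /eqP/minE min_xi; exists xi => //.
  by rewrite inE; apply/asboolP.
case=> xi; rewrite inE => /asboolP/minE card_xi ->; split; last by apply/eqP.
exact: imset_f.
Qed.

Lemma card_shift k l u : 0 < n -> k %| n -> coprime u n -> l = u * k %[mod n] ->
  #|[set xi : 'S_n | s ^+ k * xi == xi * s ^+ l]| = (k`! * (n %/ k) ^ k)%N.
Proof.
move=> n_gt0 k_n co_u l_eq; have [w conj_w] := conj_cycle_exp _ _ s_cycle u co_u.
have ord_s := order_cycle_of_length _ _ s_cycle.
have conj_k : s ^+ k * w = w * s ^+ l.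
  have -> : s ^+ l = (s ^+ k) ^ w.
    by rewrite conjXg conj_w -expgM; apply/eqP; rewrite eq_expg_mod_order ord_s l_eq.
  by rewrite conjgE mulKVg.
rewrite -(card_cent_cycle_exp n s) // -(card_rcoset _ w).
apply: eq_card => xi; rewrite mem_rcoset inE.
apply/eqP/cent1P => [eq_xi | comm_xi]; rewrite /commute.
  by rewrite mulgA eq_xi -!mulgA; congr (_ * _); apply: (mulgI w); rewrite mulKVg mulgA -conj_k mulgK.
by rewrite -{1}(mulgKV w xi) mulgA -comm_xi -!mulgA conj_k !mulgA mulgKV.
Qed.

End Classes.

(** * Counting the solutions of a shift equation by minimal shift *)

Section Recurrence.

Variables (n : nat) (s : 'S_n).
Hypothesis s_cycle : cycle_of_length n s.

Lemma shift_mul (r t q : nat) (xi : 'S_n) :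
  (s ^+ r * xi = xi * s ^+ t -> s ^+ (r * q) * xi = xi * s ^+ (t * q))%g.
Proof.
move=> eq_rt; have conj_r : ((s ^+ r) ^ xi = s ^+ t)%g by rewrite conjgE eq_rt mulKg.
by rewrite !expgM -conj_r -conjXg conjgE mulKVg.
Qed.

Lemma eq_mod_shift (a b c : nat) (xi : 'S_n) :
  (s ^+ a * xi = xi * s ^+ b)%g ->
  (s ^+ a * xi = xi * s ^+ c)%g <-> b = c %[mod n].
Proof.
move=> ->; split=> [/mulgI/eqP | eq_bc].
  by rewrite eq_expg_mod_order (order_cycle_of_length _ _ s_cycle) => /eqP.
congr (_ * _)%g; apply/eqP.
by rewrite eq_expg_mod_order (order_cycle_of_length _ _ s_cycle) eq_bc.
Qed.

(** Conjugate powers of [s] have the same order, and this order determines the gcd of the exponent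
    with [n]; the shift period itself divides [n]. *)
Lemma gcd_shift_period (t : nat) (xi : 'S_n) :
  (s ^+ shift_period s xi * xi = xi * s ^+ t)%g ->
  gcdn t n = shift_period s xi.
Proof.
set r := shift_period s xi => eq_rt.
have ord_s := order_cycle_of_length _ _ s_cycle.
have r_n : r %| n by rewrite -[n in _ %| n]ord_s shift_period_dvd_order.
have n_gt0 : 0 < n by have := order_gt0 s; rewrite ord_s.
have : (#[s ^+ t] = #[s ^+ r])%g.
  by rewrite -(orderJ (s ^+ r)%g xi) conjgE eq_rt mulKg.
rewrite !orderXgcd ord_s (gcdn_idPr r_n) gcdnC => eq_div.
have gcd_n : gcdn t n %| n by apply: dvdn_gcdr.
have d_gt0 : 0 < n %/ r.
  by rewrite divn_gt0 ?shift_period_gt0 //; apply: dvdn_leq.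
by apply/eqP; rewrite -(eqn_pmul2l d_gt0) divnK // -eq_div divnK.
Qed.

(** With [r] the shift period and [t] its exponent on the right, [gcd_shift_period] and [gcd_vertex]
    give a vertex. As [r] divides [k], either the quotient is 1 and the vertex is [(k, l)], or
    [mul_prec] gives a path. *)
Lemma minimal_shift_vertex (k l : nat) (xi : 'S_n) : vertex n (k, l) ->
  (s ^+ k * xi = xi * s ^+ l)%g ->
  exists r t, [/\ vertex n (r, t), minimal_shift s r t xi
    & (r, t) = (k, l) \/ prec n (r, t) (k, l)].
Proof.
move=> v_kl eq_kl; have [n_gt0 k_n l_range _] := vertexE _ _ v_kl.
have n_gt1 := vertex_gt1 _ _ v_kl; rewrite /= in k_n l_range.
pose r := shift_period s xi.
have [t0 eq_t0] : exists t, (s ^+ r * xi = xi * s ^+ t)%g.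
  (* The shift period divides itself, so it is an admissible exponent. *)
  by apply/mem_shift_conj; rewrite -dvdn_shift_period.
(* The factor 1 only serves to reduce [t0] to the range from 1 to [n]. *)
pose t := odot n t0 1; have t_range : 1 <= t <= n by apply: odot_range.
have eq_t : (s ^+ r * xi = xi * s ^+ t)%g.
  by apply/(eq_mod_shift _ _ _ _ eq_t0); rewrite odot_mod // muln1.
have v_rt : vertex n (r, t) by apply: gcd_vertex => //; apply: gcd_shift_period.
have /dvdnP[q def_k] : r %| k.
  by rewrite dvdn_shift_period; apply/mem_shift_conj; exists l.
have k_gt0 : 0 < k by apply: dvdn_gt0 k_n.
have {}def_k : k = r * q by rewrite def_k mulnC.
have l_eq : l = t * q %[mod n].
  by apply/(eq_mod_shift _ _ _ _ eq_kl); rewrite def_k; apply: shift_mul.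
exists r, t; split=> //; first by apply/minimal_shiftE => //; apply: shift_period_gt0.
have q_gt0 : 0 < q by move: k_gt0; rewrite def_k muln_gt0 => /andP[].
move: q_gt0; rewrite leq_eqVlt => /orP[/eqP q1 | q_gt1]; [left | right].
  congr (_, _); first by rewrite def_k -q1 muln1.
  by apply: (eq_mod_range n) => //; rewrite l_eq -q1 muln1.
rewrite (odotE n n_gt0 l t q) // def_k; apply: mul_prec => //.
by rewrite -def_k.
Qed.

Lemma minimal_shift_unique (r t r' t' : nat) (xi : 'S_n) :
  0 < r -> 0 < r' -> 1 <= t <= n -> 1 <= t' <= n ->
  minimal_shift s r t xi -> minimal_shift s r' t' xi -> (r, t) = (r', t').
Proof.
move=> r_gt0 r'_gt0 t_range t'_range.
move=> /minimal_shiftE[] // <- eq_t /minimal_shiftE[] // <- eq_t'.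
congr (_, _); apply: (eq_mod_range n) => //.
by apply/(eq_mod_shift _ _ _ _ eq_t).
Qed.

(** If the equation holds, exactly one term on the right is 1, by [minimal_shift_vertex] and
    [minimal_shift_unique]. If not, all vanish, since an equation at a predecessor multiplies up to
    the one at [(k, l)]. *)
Lemma shift_indicator (k l : nat) (xi : 'S_n) : vertex n (k, l) ->
  (xi \in [set xi | s ^+ k * xi == xi * s ^+ l]%g : nat) =
  `[< minimal_shift s k l xi >] +
    \sum_(1 <= r < n.+1) \sum_(1 <= t < n.+1 | `[< prec n (r, t) (k, l) >])
      `[< minimal_shift s r t xi >].
Proof.
move=> v_kl; have [_ _ /= l_range _] := vertexE _ _ v_kl.
have /= /andP[k_gt0 _] := vertex_range _ _ v_kl.
rewrite inE; case: eqP => [eq_kl | ne_kl]; last first.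
  case: asboolP => [[] // | _]; rewrite big1 // => r _; rewrite big1 // => t.
  move=> /asboolP/prec_mul[q /= [_ def_k l_eq]]; case: asboolP => // -[eq_rt _].
  case: ne_kl; apply/(eq_mod_shift _ (t * q)) => //.
  by rewrite def_k; apply: shift_mul.
have [r [t [v_rt min_rt rt_kl]]] := minimal_shift_vertex _ _ _ v_kl eq_kl.
have [_ _ /= t_range _] := vertexE _ _ v_rt.
have /= /andP[r_gt0 r_le] := vertex_range _ _ v_rt.
have [def_rt | rt_prec] := rt_kl.
  case: def_rt min_rt => -> -> min_kl; rewrite asboolT // big1 // => r' _.
  rewrite big1 // => t' /asboolP prec_kl; case: asboolP => // min_rt'.
  have [v_rt' _] := prec_vertex _ _ _ prec_kl.
  have [_ _ /= t'_range _] := vertexE _ _ v_rt'.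
  have /= /andP[r'_gt0 _] := vertex_range _ _ v_rt'.
  have [def_r' _] : (r', t') = (k, l) by apply: minimal_shift_unique min_rt' min_kl.
  by have := prec_lt _ _ _ prec_kl; rewrite def_r' ltnn.
rewrite asboolF => [|min_kl]; last first.
  have [def_r _] : (r, t) = (k, l) by apply: minimal_shift_unique min_rt min_kl.
  by have := prec_lt _ _ _ rt_prec; rewrite def_r ltnn.
have uniq_rt r' t' : 0 < r' -> 1 <= t' <= n -> minimal_shift s r' t' xi ->
    (r', t') = (r, t).
  by move=> r'_gt0 t'_range min_rt'; apply: minimal_shift_unique min_rt.
rewrite (bigD1_seq r) ?iota_uniq ?mem_index_iota ?r_gt0 ?ltnS //=.
rewrite (big_mkcond (fun t => `[< prec n (r, t) (k, l) >])).
rewrite (bigD1_seq t) ?iota_uniq ?mem_index_iota ?ltnS //= !asboolT //.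
rewrite !big1_seq // => [r' | t']; last first.
  rewrite mem_index_iota ltnS => /andP[ne_t t'_range]; case: ifP => // _.
  case: asboolP => // /(uniq_rt _ _ r_gt0 t'_range)[def_t].
  by rewrite def_t eqxx in ne_t.
rewrite mem_index_iota ltnS => /andP[ne_r /andP[r'_gt0 _]]; apply: big1_seq => t'.
rewrite mem_index_iota ltnS => /andP[_ t'_range].
case: asboolP => // /(uniq_rt _ _ r'_gt0 t'_range)[def_r _].
by rewrite def_r eqxx in ne_r.
Qed.

Lemma card_shift_classes (k l : nat) : vertex n (k, l) ->
  #|[set xi | s ^+ k * xi == xi * s ^+ l]%g| =
  n * (k * #|vertex_classes s (k, l)| +
    \sum_(1 <= r < n.+1) \sum_(1 <= t < n.+1 | `[< prec n (r, t) (k, l) >])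
      r * #|vertex_classes s (r, t)|).
Proof.
move=> v_kl.
have cardE (B : {set 'S_n}) : #|B| = \sum_xi (xi \in B).
  by rewrite -sum1_card big_mkcond; apply: eq_bigr => xi _; case: (xi \in B).
have card_v v : vertex n v ->
    \sum_xi `[< minimal_shift s v.1 v.2 xi >] = n * (v.1 * #|vertex_classes s v|).
  move=> v_v; have /andP[v_gt0 _] := vertex_range _ _ v_v.
  rewrite (vertex_classesE _ _ s_cycle) // mulnA -card_minimal_shift // cardE.
  by apply: eq_bigr => xi _; rewrite inE.
rewrite cardE (eq_bigr _ (fun xi _ => shift_indicator _ _ xi v_kl)) big_split /=.
rewrite (card_v (k, l)) // mulnDr; congr (_ + _).
rewrite exchange_big big_distrr; apply: eq_bigr => r _.
rewrite exchange_big big_distrr; apply: eq_bigr => t /asboolP/prec_vertex[v_rt _].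
exact: (card_v (r, t)).
Qed.

Lemma vertex_classes_recurrence (k l : nat) : vertex n (k, l) ->
  (k.-1)`! * (n %/ k) ^ k.-1 =
  k * #|vertex_classes s (k, l)| +
    \sum_(1 <= r < n.+1) \sum_(1 <= t < n.+1 | `[< prec n (r, t) (k, l) >])
      r * #|vertex_classes s (r, t)|.
Proof.
move=> v_kl; have [n_gt0 /= k_n _ [u co_u l_eq]] := vertexE _ _ v_kl.
have k_gt0 : 0 < k by apply: dvdn_gt0 k_n.
apply/eqP; rewrite -(eqn_pmul2l n_gt0) -card_shift_classes //.
rewrite (card_shift _ _ s_cycle _ _ u) //; case: k k_gt0 k_n {v_kl l_eq} => // k _ k_n.
(* A factor [k] of the factorial and a factor [n %/ k] of the power multiply to [n]. *)
by rewrite factS expnS /= mulnACA (mulnC k.+1) divnK.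
Qed.

End Recurrence.

(** * Passage to the rational numbers *)

Local Open Scope ring_scope.

Theorem theorem2 (n : nat) (n_ge1 : (1 <= n)%N) (sigma : 'S_n)
    (sigma_cycle : cycle_of_length n sigma) (k l : nat)
    (kl_vertex : vertex n (k, l)) :
  #|vertex_classes sigma (k, l)|%:R =
    k%:R^-1 *
      ((k.-1)`!%:R * (n%:R / k%:R) ^+ k.-1
       - \sum_(1 <= r < n.+1)
           \sum_(1 <= t < n.+1 | `[< prec n (r, t) (k, l) >])
             r%:R * #|vertex_classes sigma (r, t)|%:R) :> rat.
Proof.
have [_ /= k_n _ _] := vertexE _ _ kl_vertex.
have k_neq0 : k%:R != 0 :> rat.
  by rewrite Num.Theory.pnatr_eq0 -lt0n (dvdn_gt0 n_ge1 k_n).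
have /(congr1 (fun m => m%:R : rat)) := vertex_classes_recurrence _ _ sigma_cycle _ _ kl_vertex.
have <- : (n %/ k)%:R = n%:R / k%:R :> rat.
  by rewrite -[in RHS](divnK k_n) natrM mulfK.
rewrite natrD !natrM natrX natr_sum => ->.
under [X in _ + X - _]eq_bigr => r _.
  by rewrite natr_sum; under eq_bigr => t _ do rewrite natrM; over.
by rewrite addrK mulKf.
Qed.
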